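(* Let $X$ be a compact metric space and $E$ a complex Banach space. A map $T: (\operatorname{Lip}(X,E),\|\cdot\|_{L}) \to (\operatorname{Lip}(X,E),\|\cdot\|_{L})$ is a hermitian operator if and only if there exists a hermitian operator $\phi: E \to E$ such that \[ (TF)(x)=\phi(F(x)) \quad \text{for all } F \in \operatorname{Lip}(X,E),\ x \in X. \]
   Context: Metric spaces are nonempty. For a compact metric space $(X,d)$ and a complex Banach space $(E,\|\cdot\|_E)$, $\operatorname{Lip}(X,E)$ is the space of all maps $F:X\to E$ with $L(F):=\sup_{x\neq y\in X}\frac{\|F(x)-F(y)\|_E}{d(x,y)}<\infty$ (with $L(F)=0$ if $X$ is a single point). It is a Banach space with the sum norm $\|F\|_L=\sup_{x\in X}\|F(x)\|_E+L(F)$. A bounded (linear) operator $T$ on a complex normed space $(V,\|\cdot\|_V)$ is hermitian if $[Tv,v]_V\in\mathbb{R}$ for every $v\in V$, where $[\cdot,\cdot]_V$ is a semi-inner product (in the sense of Lumer) on $V$ compatible with the norm, i.e. a map $V\times V\to\mathbb{C}$, linear in the first variable, with $[v,v]_V=\|v\|_V^2$ and $|[u,v]_V|\le\|u\|_V\|v\|_V$. This definition does not depend on the choice of the compatible semi-inner product. *)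

(* Defs.v *)
From HB Require Import structures.
From mathcomp Require Import all_boot all_order all_algebra.
From mathcomp Require Import all_classical all_reals all_analysis.
From mathcomp Require Import complex.

Set Implicit Arguments.
Unset Strict Implicit.
Unset Printing Implicit Defensive.

Import Order.TTheory GRing.Theory Num.Theory.
Import numFieldNormedType.Exports.

Local Open Scope classical_set_scope.
Local Open Scope complex_scope.
Local Open Scope ring_scope.

Section Lipschitz.
Context (R : realType) (X : metricType R) (E : normedModType R[i]).
Implicit Types F G : X -> E.

(* Norms on a normed module over R[i] take values in R[i]; this is the same
   norm, valued in R. *)
Definition rnorm (V : normedModType R[i]) (v : V) : R := complex.Re `|v|.

Definition difference_quotients F : set R :=
  [set rnorm (F p.1 - F p.2) / mdist p.1 p.2 | p in [set p : X * X | p.1 != p.2]].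

(* L(F); [sup set0 = 0] gives L(F) = 0 when X is a single point. *)
Definition lip_const F : R := sup (difference_quotients F).

Definition sup_norm F : R := sup [set rnorm (F x) | x in [set: X]].

Definition is_lip : {pred X -> E} :=
  [pred F : X -> E | `[< has_ubound (difference_quotients F) >]].

Lemma rnormE (V : normedModType R[i]) (v : V) : (rnorm v)%:C = `|v|.
Proof.
by apply: RRe_real; rewrite realE normr_ge0.
Qed.

Lemma rnorm_ge0 (V : normedModType R[i]) (v : V) : 0 <= rnorm v.
Proof. by rewrite -lecR rnormE normr_ge0. Qed.

Lemma Re_norm_ge0 (a : R[i]) : 0 <= complex.Re `|a|.
Proof. by rewrite -lecR RRe_real ?normr_ge0. Qed.

Lemma Re_normM (a b : R[i]) :
  complex.Re `|a * b| = complex.Re `|a| * complex.Re `|b|.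
Proof.
have ReE (c : R[i]) : `|c| = (complex.Re `|c|)%:C.
  by rewrite RRe_real// realE normr_ge0.
by rewrite normrM [in LHS](ReE a) [in LHS](ReE b) -rmorphM.
Qed.

Lemma ler_rnormD (V : normedModType R[i]) (v w : V) :
  rnorm (v + w) <= rnorm v + rnorm w.
Proof. by rewrite -lecR rmorphD/= !rnormE ler_normD. Qed.

Lemma rnormN (V : normedModType R[i]) (v : V) : rnorm (- v) = rnorm v.
Proof. by rewrite /rnorm normrN. Qed.

Lemma rnormZ (V : normedModType R[i]) (a : R[i]) (v : V) :
  rnorm (a *: v) = complex.Re `|a| * rnorm v.
Proof.
by apply: complexI; rewrite rmorphM/= !rnormE normrZ.
Qed.

Lemma rnorm0_eq0 (V : normedModType R[i]) (v : V) : rnorm v = 0 -> v = 0.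
Proof. by move=> v0; apply: normr0_eq0; rewrite -rnormE v0. Qed.

Lemma is_lipP F : reflect
  (exists K, forall x y, rnorm (F x - F y) <= K * mdist x y) (F \in is_lip).
Proof.
apply: (iffP (asboolP _)) => -[K KF]; exists K.
  move=> x y; have [->|xy] := eqVneq x y.
    by rewrite subrr /rnorm normr0 mdistxx mulr0.
  by rewrite -ler_pdivrMr ?mdist_gt0//; apply: KF; exists (x, y).
by move=> _ [[x y]/= xy <-]; rewrite ler_pdivrMr ?mdist_gt0.
Qed.

Lemma is_lip_submod : submod_closed is_lip.
Proof.
split=> [|a F G /is_lipP[K KF] /is_lipP[K' KG]]; apply/is_lipP.
  by exists 0 => x y; rewrite subrr /rnorm normr0 mul0r.
exists (complex.Re `|a| * K + K') => x y.
have -> : (a *: F + G) x - (a *: F + G) y = a *: (F x - F y) + (G x - G y).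
  by rewrite scalerBr opprD addrACA.
rewrite (le_trans (ler_rnormD _ _))// rnormZ mulrDl lerD//.
by rewrite -mulrA ler_wpM2l// Re_norm_ge0.
Qed.

HB.instance Definition _ :=
  GRing.isSubmodClosed.Build R[i] (X -> E) is_lip is_lip_submod.

(* The compactness proof is a parameter of the type because the norm below
   needs Lipschitz maps to be bounded. *)
Definition Lip (cX : compact [set: X]) := {F : X -> E | F \in is_lip}.

Context (cX : compact [set: X]).
Local Notation LipX := (Lip cX).

Definition lip_fun (F : LipX) : X -> E := val F.

HB.instance Definition _ := SubType.copy LipX {F : X -> E | F \in is_lip}.
HB.instance Definition _ := Choice.copy LipX {F : X -> E | F \in is_lip}.
HB.instance Definition _ := [SubChoice_isSubLmodule of LipX by <:].

Lemma rnorm_lip_continuous F : F \in is_lip ->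
  continuous ((fun x => rnorm (F x)) : X -> R^o).
Proof.
move=> /is_lipP[K KF] x; apply/cvgrPdist_lt => e e0.
have K1 : 0 < `|K| + 1 by rewrite ltr_wpDl.
near=> y.
apply: (@le_lt_trans _ _ (K * mdist x y)).
  rewrite ler_norml; apply/andP; split.
    rewrite lerNl opprB lerBlDr (le_trans _ (lerD (KF x y) (lexx _)))//.
    by rewrite -[rnorm (_ - _)]rnormN opprB (le_trans _ (ler_rnormD _ _))// subrK.
  rewrite lerBlDr (le_trans _ (lerD (KF x y) (lexx _)))//.
  by rewrite (le_trans _ (ler_rnormD _ _))// subrK.
have : mdist x y < e / (`|K| + 1).
  near: y.
  have := nbhsx_ballx x _ (divr_gt0 e0 K1).
  by rewrite ballEmdist.
rewrite ltr_pdivlMr// mulrC; apply: le_lt_trans.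
by rewrite ler_wpM2r ?mdist_ge0// (le_trans (ler_norm K))// lerDl.
Unshelve. all: by end_near. Qed.

Lemma lip_bounded F : F \in is_lip ->
  has_ubound [set rnorm (F x) | x in [set: X]].
Proof.
move=> /rnorm_lip_continuous Fc.
have /compact_bounded : compact (((fun x => rnorm (F x)) : X -> R^o) @` [set: X]).
  by apply: continuous_compact => //; exact: continuous_subspaceT.
move=> [M [Mr /(_ (M + 1))]]; rewrite ltrDl ltr01 => /(_ isT) FM.
exists (M + 1) => _ [x _ <-].
by rewrite (le_trans (ler_norm _))//; apply: FM; exists x.
Qed.

Definition lip_norm (F : LipX) : R := sup_norm (lip_fun F) + lip_const (lip_fun F).

Lemma rnorm_sup_norm (F : LipX) x : rnorm (lip_fun F x) <= sup_norm (lip_fun F).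
Proof. by apply: ub_le_sup; [exact/lip_bounded/valP | exists x]. Qed.

Lemma sup_ge0 (A : set R) : (forall r, A r -> 0 <= r) -> 0 <= sup A.
Proof.
move=> A0; have [hA|/sup_out->//] := pselect (has_sup A).
have [[r Ar] uA] := hA.
by rewrite (le_trans (A0 _ Ar))// ub_le_sup.
Qed.

Lemma sup_norm_ge0 (F : LipX) : 0 <= sup_norm (lip_fun F).
Proof. by apply: sup_ge0 => _ [x _ <-]; exact: rnorm_ge0. Qed.

Lemma lip_const_ge0 (F : LipX) : 0 <= lip_const (lip_fun F).
Proof.
by apply: sup_ge0 => _ [p _ <-]; rewrite divr_ge0 ?rnorm_ge0 ?mdist_ge0.
Qed.

Lemma sup_norm_le (F : X -> E) (c : R) : 0 <= c ->
  (forall x, rnorm (F x) <= c) -> sup_norm F <= c.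
Proof.
move=> c0 Fc; rewrite /sup_norm; set A := [set _ | _ in _].
have [->|/set0P A0] := eqVneq A set0; first by rewrite sup0.
by apply: ge_sup => // _ [x _ <-].
Qed.

Lemma lip_const_le (F : X -> E) (c : R) : 0 <= c ->
  (forall x y, rnorm (F x - F y) <= c * mdist x y) -> lip_const F <= c.
Proof.
move=> c0 Fc; rewrite /lip_const.
have [->|/set0P A0] := eqVneq (difference_quotients F) set0.
  by rewrite sup0.
by apply: ge_sup => // _ [[x y]/= xy <-]; rewrite ler_pdivrMr ?mdist_gt0.
Qed.

Lemma lip_constP (F : LipX) x y :
  rnorm (lip_fun F x - lip_fun F y) <= lip_const (lip_fun F) * mdist x y.
Proof.
have [->|xy] := eqVneq x y.
  by rewrite subrr /rnorm normr0 mdistxx mulr0.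
rewrite -ler_pdivrMr ?mdist_gt0//; apply: ub_le_sup; last by exists (x, y).
exact/asboolP/(valP F).
Qed.

Lemma ler_lip_normD (F G : LipX) : lip_norm (F + G) <= lip_norm F + lip_norm G.
Proof.
rewrite /lip_norm addrACA lerD//.
  apply: sup_norm_le => [|x]; first by rewrite addr_ge0 ?sup_norm_ge0.
  by rewrite (le_trans (ler_rnormD _ _))// lerD ?rnorm_sup_norm.
apply: lip_const_le => [|x y]; first by rewrite addr_ge0 ?lip_const_ge0.
have -> : lip_fun (F + G) x - lip_fun (F + G) y =
    (lip_fun F x - lip_fun F y) + (lip_fun G x - lip_fun G y).
  by rewrite addrACA -opprD.
by rewrite (le_trans (ler_rnormD _ _))// mulrDl lerD ?lip_constP.
Qed.

Lemma ler_lip_normZ (a : R[i]) (F : LipX) :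
  lip_norm (a *: F) <= complex.Re `|a| * lip_norm F.
Proof.
have a0 := Re_norm_ge0 a.
rewrite /lip_norm mulrDr lerD//.
  apply: sup_norm_le => [|x]; first by rewrite mulr_ge0 ?sup_norm_ge0.
  by rewrite rnormZ ler_wpM2l ?rnorm_sup_norm.
apply: lip_const_le => [|x y]; first by rewrite mulr_ge0 ?lip_const_ge0.
have -> : lip_fun (a *: F) x - lip_fun (a *: F) y =
    a *: (lip_fun F x - lip_fun F y) by rewrite scalerBr.
by rewrite rnormZ -mulrA ler_wpM2l ?lip_constP.
Qed.

Lemma lip_norm0_eq0 (F : LipX) : lip_norm F = 0 -> F = 0.
Proof.
move=> F0; apply/val_inj/funext => x; apply: rnorm0_eq0.
apply/eqP; rewrite eq_le rnorm_ge0 andbT (le_trans (rnorm_sup_norm F x))//.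
by rewrite -F0 lerDl lip_const_ge0.
Qed.

Lemma lip_normZ (a : R[i]) (F : LipX) :
  (lip_norm (a *: F))%:C = `|a| * (lip_norm F)%:C.
Proof.
rewrite -[`|a|]RRe_real ?realE ?normr_ge0// -rmorphM; congr _%:C.
apply/eqP; rewrite eq_le ler_lip_normZ andTb.
have [->|a0] := eqVneq a 0.
  by rewrite normr0 mul0r; exact: addr_ge0 (sup_norm_ge0 _) (lip_const_ge0 _).
have := ler_lip_normZ a^-1 (a *: F).
rewrite scalerA mulVf// scale1r => /(ler_wpM2l _) h.
have a0' := Re_norm_ge0 a.
apply: le_trans (h _ a0') _; rewrite mulrA.
suff -> : complex.Re `|a| * complex.Re `|a^-1| = 1 by rewrite mul1r.
by rewrite -Re_normM mulfV// normr1.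
Qed.

Lemma ler_lip_normDC (F G : LipX) :
  (lip_norm (F + G))%:C <= (lip_norm F)%:C + (lip_norm G)%:C.
Proof. by rewrite -rmorphD/= lecR ler_lip_normD. Qed.

Lemma lip_normC0_eq0 (F : LipX) : (lip_norm F)%:C = 0 -> F = 0.
Proof. by move=> /complexI; exact: lip_norm0_eq0. Qed.

HB.instance Definition _ := Lmodule_isNormed.Build R[i] LipX
  ler_lip_normDC lip_normZ lip_normC0_eq0.

Lemma lip_normE (F : LipX) :
  `|F| = (sup_norm (lip_fun F) + lip_const (lip_fun F))%:C.
Proof. by []. Qed.

End Lipschitz.

Coercion lip_fun : Lip >-> Funclass.

Arguments Lip {R X} E cX.

Section Hermitian.
Context (R : realType) (V : normedModType R[i]).

Definition semi_inner_product (s : V -> V -> R[i]) : Prop :=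
  [/\ forall (a : R[i]) (u v w : V), s (a *: u + v) w = a * s u w + s v w,
      forall v, s v v = `|v| ^+ 2
    & forall u v, `|s u v| <= `|u| * `|v|].

Definition bounded_operator (T : V -> V) : Prop :=
  linear T /\ exists M : R, forall v, `|T v| <= M%:C * `|v|.

(* All compatible semi-inner products give the same condition, and one always
   exists by Hahn-Banach. *)
Definition hermitian_operator (T : V -> V) : Prop :=
  bounded_operator T /\
  exists2 s, semi_inner_product s & forall v, s (T v) v \is Num.real.

End Hermitian.

(* Main.v *)
(* If T acts pointwise by a hermitian phi, then supporting functionals for the
   sup norm and for L are limits along an ultrafilter of normalized functionals
   built from a semi-inner product of E; their sums support ||.||_L and are real on TF.

   Conversely, a hermitian T satisfies ||F + iaTF|| <= ||F|| + a^2 ||TTF|| for all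
   real a. Comparing a with -a at a constant F gives L(TF) = 0, so T maps constants
   to constants and defines an operator phi on E. Let F(x1) = 0 and e = TF(x1), and
   write d for the distance. For large k and c, the function F - k d(., x1) e + m e
   attains its sup norm |m||e| at x1 for several m of the same modulus. The convexity
   of a |-> L(F + iaTF) makes Im (conj m * z) independent of m, where
   z = [T(F - k d(., x1) e)(x1), e]; hence z = 0. The same holds with F replaced by 0,
   so [TF(x1), e] = 0, that is, TF(x1) = 0. Subtracting the constant F(x) from F then
   yields TF(x) = phi(F(x)). *)

Require Import Defs.
From mathcomp Require Import all_boot all_order all_algebra.
From mathcomp Require Import all_classical all_reals all_analysis.
From mathcomp Require Import complex.
From mathcomp Require Import ring lra.

Set Implicit Arguments.
Unset Strict Implicit.
Unset Printing Implicit Defensive.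

Import Order.TTheory GRing.Theory Num.Theory.
Import numFieldNormedType.Exports.

Local Open Scope classical_set_scope.
Local Open Scope complex_scope.
Local Open Scope ring_scope.

(** * The real-valued modulus and the parts of a complex number *)

Section ComplexModulus.
Context (R : realType).
Implicit Types z : R[i].

Lemma cabsE z :
  complex.Re `|z| = Num.sqrt (complex.Re z ^+ 2 + complex.Im z ^+ 2).
Proof. by rewrite normc_def. Qed.

Lemma sqr_cabs z :
  complex.Re `|z| ^+ 2 = complex.Re z ^+ 2 + complex.Im z ^+ 2.
Proof. by rewrite cabsE sqr_sqrtr// addr_ge0 ?sqr_ge0. Qed.

Lemma cabs_le z (B : R) : 0 <= B ->
  complex.Re z ^+ 2 + complex.Im z ^+ 2 <= B ^+ 2 -> complex.Re `|z| <= B.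
Proof.
by move=> B0 zB; rewrite -(@ler_pXn2r _ 2) ?nnegrE ?Re_norm_ge0// sqr_cabs.
Qed.

Lemma Re_le_cabs z : `|complex.Re z| <= complex.Re `|z|.
Proof. by rewrite cabsE -sqrtr_sqr ler_wsqrtr// lerDl sqr_ge0. Qed.

Lemma Im_le_cabs z : `|complex.Im z| <= complex.Re `|z|.
Proof. by rewrite cabsE -sqrtr_sqr ler_wsqrtr// lerDr sqr_ge0. Qed.

Lemma complex_Im_real z : (z \is Num.real) = (complex.Im z == 0).
Proof. by case: z => a b; rewrite complex_real. Qed.

Lemma cabs_real (r : R) : complex.Re `|r%:C| = `|r|.
Proof. by rewrite cabsE/= expr0n addr0 sqrtr_sqr. Qed.

Lemma ler_cabsD z1 z2 :
  complex.Re `|z1 + z2| <= complex.Re `|z1| + complex.Re `|z2|.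
Proof. exact: (@ler_rnormD R (R[i]^o)). Qed.

Lemma Re_mulD (a z w : R[i]) : complex.Re (a * z + w) =
  complex.Re a * complex.Re z - complex.Im a * complex.Im z + complex.Re w.
Proof. by case: a z w => [? ?] [? ?] [? ?]. Qed.

Lemma Im_mulD (a z w : R[i]) : complex.Im (a * z + w) =
  complex.Re a * complex.Im z + complex.Im a * complex.Re z + complex.Im w.
Proof. by case: a z w => [? ?] [? ?] [? ?]. Qed.

End ComplexModulus.

(** * Limits of bounded complex functions along an ultrafilter *)

Section UltraLimit.
Context (R : realType) (I : Type) (U : set_system I) (UU : UltraFilter U).

(** Compactness of [[-B, B]] gives a cluster point of the image of [U]; an ultrafilter converges to
    its cluster points. *)
Lemma ultra_bounded_cvg (u : I -> R) (B : R) :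
  (forall i, `|u i| <= B) -> cvg (u @ U).
Proof.
move=> uB.
have Uu : U (u @^-1` [set` `[- B, B]]).
  by apply: filterE => i /=; rewrite in_itv/= -ler_norml.
have [l [_ cl]] := @segment_compact R (- B) B (u @ U) _ Uu.
apply/cvg_ex; exists l => A Al.
have [//|UnA] := in_ultra_setVsetC (u @^-1` A) UU.
by have [x [nAx Ax]] := cl (~` A) A UnA Al.
Qed.

Definition ultra_lim (g : I -> R[i]) : R[i] :=
  (lim ((fun i => complex.Re (g i)) @ U)) +i*
  (lim ((fun i => complex.Im (g i)) @ U)).

Section Bounded.
Context (g : I -> R[i]) (B : R) (gB : forall i, complex.Re `|g i| <= B).

Lemma ultra_lim_Re : (fun i => complex.Re (g i)) @ U --> complex.Re (ultra_lim g).
Proof.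
apply: (@ultra_bounded_cvg _ B) => i.
exact: le_trans (Re_le_cabs _) (gB i).
Qed.

Lemma ultra_lim_Im : (fun i => complex.Im (g i)) @ U --> complex.Im (ultra_lim g).
Proof.
apply: (@ultra_bounded_cvg _ B) => i.
exact: le_trans (Im_le_cabs _) (gB i).
Qed.

(** The squared modulus is polynomial in the two parts, so its bound passes to the limit. *)
Lemma ultra_lim_le : 0 <= B -> complex.Re `|ultra_lim g| <= B.
Proof.
move=> B0; apply: cabs_le => //.
have cR := ultra_lim_Re; have cI := ultra_lim_Im.
have := cvgD (cvgM cR cR) (cvgM cI cI) => /(_ _ _ _) c.
rewrite !expr2 -(cvg_lim _ c)//.
apply: limr_le; first by apply/cvg_ex; eexists; exact: c.
apply: nearW => i; rewrite -expr2 fctE /= -!expr2 -sqr_cabs ler_pXn2r//.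
by rewrite nnegrE Re_norm_ge0.
Qed.

Lemma ultra_lim_real : (forall i, g i \is Num.real) -> ultra_lim g \is Num.real.
Proof.
move=> gr; rewrite complex_Im_real/=; apply/eqP.
rewrite (_ : (fun i => _) = cst 0) ?lim_cst//.
by apply/funext => i; apply/eqP; rewrite -complex_Im_real.
Qed.

End Bounded.

Lemma ultra_lim_eq (g : I -> R[i]) (z : R[i]) :
  (fun i => complex.Re (g i)) @ U --> complex.Re z ->
  (fun i => complex.Im (g i)) @ U --> complex.Im z -> ultra_lim g = z.
Proof. by case: z => a b /= ga gb; congr Complex; exact: cvg_lim. Qed.

Lemma ultra_lim_linear (a : R[i]) (g h : I -> R[i]) (B B' : R) :
  (forall i, complex.Re `|g i| <= B) -> (forall i, complex.Re `|h i| <= B') ->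
  ultra_lim (fun i => a * g i + h i) = a * ultra_lim g + ultra_lim h.
Proof.
move=> gB hB'; apply: ultra_lim_eq.
  under eq_fun do rewrite Re_mulD; rewrite Re_mulD.
  apply: cvgD (ultra_lim_Re hB'); apply: cvgB; apply: cvgMr.
    exact: ultra_lim_Re gB.
  exact: ultra_lim_Im gB.
under eq_fun do rewrite Im_mulD; rewrite Im_mulD.
apply: cvgD (ultra_lim_Im hB'); apply: cvgD; apply: cvgMr.
  exact: ultra_lim_Im gB.
exact: ultra_lim_Re gB.
Qed.

End UltraLimit.

(** * Functionals supporting a seminorm at a vector *)

Section SupportingFunctionals.
Context (R : realType).

Definition supports (V : lmodType R[i]) (p : V -> R) (v : V)
    (f : V -> R[i]) : Prop :=
  [/\ forall (a : R[i]) (u w : V), f (a *: u + w) = a * f u + f w,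
      f v = (p v)%:C
    & forall u, complex.Re `|f u| <= p u].

(** This handles the sum norm: its two summands can be supported separately. *)
Lemma supportsD (V : lmodType R[i]) (p q : V -> R) (v : V) (f g : V -> R[i]) :
  supports p v f -> supports q v g ->
  supports (fun u => p u + q u) v (fun u => f u + g u).
Proof.
move=> [fl fv fp] [gl gv gq]; split => [a u w||u].
- by rewrite fl gl mulrDr addrACA.
- by rewrite fv gv rmorphD.
- by rewrite (le_trans (ler_cabsD _ _))// lerD.
Qed.

Section SemiInnerProduct.
Context (E : normedModType R[i]) (s : E -> E -> R[i]).
Hypothesis sP : semi_inner_product s.

Lemma sip_le u v : complex.Re `|s u v| <= rnorm u * rnorm v.
Proof.
have [_ _ /(_ u v)] := sP.
by rewrite -!rnormE -rmorphM -[`|s u v|]RRe_real ?realE ?normr_ge0//= lecR.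
Qed.

Lemma sip_diag v : s v v = (rnorm v ^+ 2)%:C.
Proof. by have [_ -> _] := sP; rewrite -rnormE rmorphXn. Qed.

(* A supremum of seminorms [rnorm (q i _)] need not be attained, so the
   supporting functional is a limit of normalized functionals [s (q i _) (q i v)]
   along an ultrafilter. *)
Lemma exists_supporting (V : lmodType R[i]) (I : Type) (q : I -> V -> E)
    (p : V -> R) (v : V) :
  (forall i (a : R[i]) u w, q i (a *: u + w) = a *: q i u + q i w) ->
  (forall u, 0 <= p u) -> (forall i u, rnorm (q i u) <= p u) ->
  (p v != 0 -> forall e : R, 0 < e -> exists i, p v - e < rnorm (q i v)) ->
  exists2 f, supports p v f &
    forall w, (forall i, s (q i w) (q i v) \is Num.real) -> f w \is Num.real.
Proof.
move=> ql p0 qp pv; have [pv0|pv0] := eqVneq (p v) 0.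
  exists (fun=> 0) => [|w _]; last exact: real0.
  by split => [a u w||u]; rewrite ?pv0 ?mulr0 ?addr0// normr0.
have /choice[i iP] : forall n : nat, exists i, p v - n.+1%:R^-1 < rnorm (q i v).
  by move=> n; apply: pv => //; rewrite invr_gt0.
(* Since [U] refines [\oo], ordinary limits persist along [U]. *)
have [U [UU sU]] := @ultraFilterLemma nat \oo _.
pose g w n := s (q (i n) w) (q (i n) v).
have gB w n : complex.Re `|g w n| <= p w * p v.
  by rewrite (le_trans (sip_le _ _))// ler_pM ?rnorm_ge0.
(* At [v] the products are squared norms tending to [p v ^+ 2], hence the factor [(p v)^-1]. *)
exists (fun w => (p v)^-1%:C * ultra_lim U (g w)); last first.
  move=> w wr; rewrite realM//; first by rewrite complex_Im_real.
  by apply: ultra_lim_real => n; exact: wr.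
split => [a u w||u].
- have [sl _ _] := sP.
  rewrite (_ : g _ = (fun n => a * g u n + g w n)); last first.
    by apply/funext => n; rewrite /g ql sl.
  by rewrite (ultra_lim_linear _ _ (gB u) (gB w)) mulrDr mulrCA.
- rewrite (@ultra_lim_eq _ _ _ _ _ (p v ^+ 2)%:C) ?complexRe//=.
  + by rewrite -rmorphM expr2 mulKf.
  + rewrite (_ : (fun n => _) = (fun n => rnorm (q (i n) v) ^+ 2)); last first.
      by apply/funext => n; rewrite /g sip_diag.
    have cv : (fun n => rnorm (q (i n) v)) @ U --> p v.
      apply: cvg_trans (_ : (fun n => rnorm (q (i n) v)) @ \oo --> p v).
        exact: cvg_fmap2.
      apply: (@squeeze_cvgr _ _ _ _ (fun n => p v - n.+1%:R^-1) (cst (p v))).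
      * by apply: nearW => n; rewrite ltW//= qp.
      * rewrite -[X in _ --> X]subr0; apply: cvgB; first exact: cvg_cst.
        exact: cvg_harmonic.
      * exact: cvg_cst.
    by rewrite expr2; under eq_fun do rewrite expr2; exact: cvgM.
  + rewrite (_ : (fun n => _) = cst 0); first exact: cvg_cst.
    by apply/funext => n; rewrite /g sip_diag.
- rewrite Re_normM cabs_real ger0_norm ?invr_ge0// mulrC ler_pdivrMr ?lt0r ?pv0 ?p0//.
  by apply: ultra_lim_le => //; rewrite mulr_ge0.
Qed.

End SemiInnerProduct.
End SupportingFunctionals.

(** * Pointwise action of a hermitian operator is hermitian *)

Section Sufficiency.
Context (R : realType) (X : metricType R) (cX : compact [set: X]).
Context (E : normedModType R[i]).
Local Notation LipX := (Lip E cX).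

(** Vector-valued and linear in [F], so that L is a supremum of seminorms as in
    [exists_supporting]. *)
Definition difference_quotient (p : {p : X * X | p.1 != p.2}) (F : LipX) : E :=
  (mdist (val p).1 (val p).2)^-1%:C *: (F (val p).1 - F (val p).2).

Lemma rnorm_difference_quotient p (F : LipX) :
  rnorm (difference_quotient p F) =
  rnorm (F (val p).1 - F (val p).2) / mdist (val p).1 (val p).2.
Proof.
by rewrite rnormZ cabs_real ger0_norm ?invr_ge0 ?mdist_ge0// mulrC.
Qed.

(** As [sup set0 = 0], a nonzero supremum makes [A] nonempty. *)
Lemma sup_adherent_neq0 (A : set R) : has_ubound A -> sup A != 0 ->
  forall e, 0 < e -> exists2 r, A r & sup A - e < r.
Proof.
move=> Aub A0 e e0; apply: sup_adherent => //; split => //.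
by apply/set0P; apply: contra_neq A0 => ->; exact: sup0.
Qed.

Lemma exists_supporting_sup_norm (s : E -> E -> R[i]) (F : LipX) :
  semi_inner_product s ->
  exists2 f, supports (fun G : LipX => sup_norm G) F f &
    forall G : LipX, (forall x, s (G x) (F x) \is Num.real) -> f G \is Num.real.
Proof.
move=> sP; apply: (exists_supporting sP (q := fun x (G : LipX) => G x)) => //.
- by move=> u; exact: sup_norm_ge0.
- by move=> x u; exact: rnorm_sup_norm.
move=> /(sup_adherent_neq0 (lip_bounded cX (valP F))) sF e /sF[_ [x _ <-] ?].
by exists x.
Qed.

Lemma exists_supporting_lip_const (s : E -> E -> R[i]) (F : LipX) :
  semi_inner_product s ->
  exists2 f, supports (fun G : LipX => lip_const G) F f &
    forall G : LipX,
      (forall p, s (difference_quotient p G) (difference_quotient p F) \is Num.real) ->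
      f G \is Num.real.
Proof.
move=> sP; apply: (exists_supporting sP) => //.
- move=> p a u w; rewrite /difference_quotient scalerA mulrC -scalerA -scalerDr.
  by congr (_ *: _); rewrite scalerBr addrACA -opprD.
- by move=> u; exact: lip_const_ge0.
- move=> p u; rewrite rnorm_difference_quotient ler_pdivrMr ?mdist_gt0 ?(valP p)//.
  exact: lip_constP.
have /asboolP Fub := valP F.
move=> /(sup_adherent_neq0 Fub) sF e /sF[_ [p pne <-] ?].
by exists (exist _ p pne); rewrite rnorm_difference_quotient.
Qed.

(** Since [phi] commutes with evaluations and difference quotients, all products involved have the
    form [s (phi v) v], which is real. *)
Lemma hermitian_pointwise (phi : E -> E) (T : LipX -> LipX) :
  hermitian_operator phi -> (forall (F : LipX) x, T F x = phi (F x)) ->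
  hermitian_operator T.
Proof.
move=> [[phil [M0 phiM0]] [s sP sphi]] Tphi.
have [M M_ge0 phiM] : exists2 M, 0 <= M & forall v, rnorm (phi v) <= M * rnorm v.
  exists `|M0| => // v; have := phiM0 v.
  rewrite -!rnormE -rmorphM lecR => /le_trans; apply.
  by rewrite ler_wpM2r ?rnorm_ge0 ?ler_norm.
have phiB u v : phi (u - v) = phi u - phi v.
  by rewrite addrC -scaleN1r phil scaleN1r addrC.
have phiZ (a : R[i]) u : phi (a *: u) = a *: phi u.
  have phi0 : phi 0 = 0 by have := phiB 0 0; rewrite !subrr.
  by rewrite -[a *: u]addr0 phil phi0 addr0.
have Tq p (F : LipX) : difference_quotient p (T F) = phi (difference_quotient p F).
  by rewrite /difference_quotient !Tphi phiZ phiB.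
split; first split.
- move=> a F G; apply/val_inj/funext => x.
  have -> : val (a *: T F + T G) x = a *: T F x + T G x by [].
  by rewrite -[val _ _]/(T _ x) !Tphi phil.
- exists M => F; rewrite !lip_normE -rmorphM lecR mulrDr lerD//.
    apply: sup_norm_le => [|x]; first by rewrite mulr_ge0 ?sup_norm_ge0.
    by rewrite Tphi (le_trans (phiM _))// ler_wpM2l ?rnorm_sup_norm.
  apply: lip_const_le => [|x y]; first by rewrite mulr_ge0 ?lip_const_ge0.
  by rewrite !Tphi -phiB (le_trans (phiM _))// -mulrA ler_wpM2l ?lip_constP.
have /choice[f fP] : forall F : LipX, exists f : LipX -> R[i],
    supports (fun G : LipX => lip_norm G) F f /\ f (T F) \is Num.real.
  move=> F; have [f fF fr] := exists_supporting_sup_norm F sP.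
  have [g gF gr] := exists_supporting_lip_const F sP.
  exists (fun G => f G + g G); split; first exact: supportsD.
  by rewrite realD ?fr ?gr// => i; rewrite ?Tphi ?Tq sphi.
(* [f F F] is the norm of [F]; the extra factor makes it the square. *)
exists (fun G F => (lip_norm F)%:C * f F G) => [|F]; last first.
  by rewrite realM ?(fP F).2// complex_Im_real.
split => [a u v w|v|u v].
- by have [[fl _ _] _] := fP w; rewrite fl mulrDr mulrCA.
- have [[_ fv _] _] := fP v; by rewrite fv lip_normE -expr2.
- have [[_ _ fv] _] := fP v.
  rewrite mulrC normrM ler_pM//; last first.
    by rewrite ger0_norm// ler0c addr_ge0 ?sup_norm_ge0 ?lip_const_ge0.
  by rewrite -[`|f _ _|]RRe_real ?realE ?normr_ge0//= lip_normE lecR fv.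
Qed.

End Sufficiency.

(** * The quadratic growth bound for hermitian operators *)

Section Growth.
Context (R : realType).

Lemma le0_of_linear_bound (x C : R) : (forall a, 0 < a -> x <= a * C) -> x <= 0.
Proof.
move=> xC; rewrite leNgt; apply/negP => x0.
have C1 : 0 < `|C| + 1 by rewrite ltr_wpDl.
have := xC _ (divr_gt0 x0 C1); apply/negP; rewrite -ltNge.
rewrite mulrAC ltr_pdivrMr// ltr_pM2l//.
by rewrite (le_lt_trans (ler_norm C))// ltrDl.
Qed.

(* Lumer's argument: [I - iaT] is expansive because of the semi-inner product,
   and [(I - iaT)(I + iaT) = I + a^2 T^2]. *)
Lemma hermitian_growth (V : normedModType R[i]) (T : V -> V) :
  hermitian_operator T -> forall v (a : R),
  rnorm (v + (0 +i* a) *: T v) <= rnorm v + a ^+ 2 * rnorm (T (T v)).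
Proof.
move=> [[Tl _] [s sP sT]] v a.
(* As [[Tu, u]] is real, [[u + ibTu, u]] has real part [|u|^2]. *)
have expansive u (b : R) : rnorm u <= rnorm (u + (0 +i* b) *: T u).
  have [->|u0] := eqVneq (rnorm u) 0; first exact: rnorm_ge0.
  have un0 : 0 < rnorm u by rewrite lt0r u0 rnorm_ge0.
  rewrite -(ler_pM2r un0); apply: le_trans (sip_le sP _ _).
  apply: le_trans (Re_le_cabs _); apply: le_trans (ler_norm _).
  have [sl _ _] := sP; rewrite addrC sl (sip_diag sP) Re_mulD/=.
  have := sT u; rewrite complex_Im_real => /eqP ->.
  by rewrite mul0r mulr0 subrr add0r expr2.
apply: (le_trans (expansive _ (- a))).
have -> : v + (0 +i* a) *: T v + (0 +i* - a) *: T (v + (0 +i* a) *: T v) =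
    v + (a ^+ 2)%:C *: T (T v).
  have -> : T (v + (0 +i* a) *: T v) = T v + (0 +i* a) *: T (T v).
    by rewrite addrC Tl addrC.
  rewrite scalerDr scalerA addrA -[v + _ + _]addrA -scalerDl.
  have -> : (0 +i* a) + (0 +i* - a) = 0 :> R[i].
    by apply/eqP; rewrite eq_complex /= addr0 subrr eqxx.
  rewrite scale0r addr0; congr (_ + _ *: _).
  by apply/eqP; rewrite eq_complex /=; apply/andP; split; apply/eqP; ring.
rewrite (le_trans (ler_rnormD _ _))// lerD2l rnormZ cabs_real.
by rewrite ger0_norm ?sqr_ge0.
Qed.

End Growth.

(** * Hermitian operators map constants to constants *)

Section Necessity.
Context (R : realType) (X : metricType R) (cX : compact [set: X]).
Context (E : normedModType R[i]).
Local Notation LipX := (Lip E cX).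

Local Notation fn := (@lip_fun R X E cX).

Lemma is_lip_cst (e : E) : (fun=> e : E) \in @is_lip R X E.
Proof.
by apply/is_lipP; exists 0 => x y; rewrite subrr /rnorm normr0 mul0r.
Qed.

Definition lip_cst (e : E) : LipX := exist (fun F => F \in @is_lip R X E) _ (is_lip_cst e).

Lemma is_lip_dist (x0 : X) (e : E) :
  (fun x => (mdist x x0)%:C *: e) \in @is_lip R X E.
Proof.
apply/is_lipP; exists (rnorm e) => x y.
rewrite -scalerBl -rmorphB rnormZ cabs_real mulrC ler_wpM2l ?rnorm_ge0//.
rewrite ler_norml; apply/andP; split.
  by have := metric_triangle y x x0; rewrite [mdist y x]metric_sym; lra.
by have := metric_triangle x y x0; lra.
Qed.

Definition lip_dist (x0 : X) (e : E) : LipX := exist (fun F => F \in @is_lip R X E) _ (is_lip_dist x0 e).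

Lemma lip_cst_linear (a : R[i]) u v :
  lip_cst (a *: u + v) = a *: lip_cst u + lip_cst v.
Proof. exact/val_inj. Qed.

Lemma lip_const_addcst (F : LipX) e : lip_const (fn (F + lip_cst e)) = lip_const F.
Proof.
rewrite /lip_const; congr sup; apply: eq_imagel => -[x y] _ /=.
congr (rnorm _ / _).
have -> : fn (F + lip_cst e) x - fn (F + lip_cst e) y = (F x + e) - (F y + e) by [].
by rewrite opprD addrACA subrr addr0.
Qed.

(** Midpoint convexity of L, used to compare the parameters [a] and [-a]. *)
Lemma lip_const_midpoint (F G : LipX) :
  lip_const F *+ 2 <= lip_const (fn (F + G)) + lip_const (fn (F - G)).
Proof.
set c := _ + _; have c0 : 0 <= c by rewrite addr_ge0 ?lip_const_ge0.
rewrite -mulr_natr -ler_pdivlMr//; apply: lip_const_le => [|x y].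
  by rewrite divr_ge0.
rewrite mulrAC ler_pdivlMr// mulr_natr mulrDl.
apply: le_trans (lerD (lip_constP _ _ _) (lip_constP _ _ _)).
apply: le_trans (ler_rnormD _ _).
have -> : fn (F + G) x - fn (F + G) y + (fn (F - G) x - fn (F - G) y) =
    (F x + G x) - (F y + G y) + ((F x - G x) - (F y - G y)) by [].
have -> : (F x + G x) - (F y + G y) + ((F x - G x) - (F y - G y)) =
    (2%:R : R[i]) *: (F x - F y).
  rewrite addrACA -opprD [F x + _ + _]addrACA [F y + _ + _]addrACA.
  by rewrite !subrr !addr0 opprD addrACA scaler_nat mulr2n.
by rewrite rnormZ -(rmorph_nat (real_complex R)) cabs_real normr_nat mulr_natl.
Qed.

Context (T : LipX -> LipX) (hT : hermitian_operator T).

Let T_linear (a : R[i]) F G : T (a *: F + G) = a *: T F + T G.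
Proof. by have [[Tl _] _] := hT; rewrite Tl. Qed.

Let T_addcst (F : LipX) e : T (F + lip_cst e) = T F + T (lip_cst e).
Proof. by have := T_linear 1 F (lip_cst e); rewrite !scale1r. Qed.

Lemma lip_growth (F : LipX) (a : R) (x : X) :
  rnorm (F x + (0 +i* a) *: T F x) + lip_const (fn (F + (0 +i* a) *: T F)) <=
  sup_norm F + lip_const F + a ^+ 2 * rnorm (T (T F)).
Proof.
apply: le_trans (hermitian_growth hT F a).
rewrite [leRHS]/(lip_norm _) /lip_norm lerD2r.
exact: (rnorm_sup_norm (F + (0 +i* a) *: T F)).
Qed.

Lemma sup_norm_cst e : sup_norm (lip_cst e) <= rnorm e.
Proof. by apply: sup_norm_le => //; exact: rnorm_ge0. Qed.

Lemma lip_const_cst e : lip_const (lip_cst e) = 0.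
Proof.
apply/eqP; rewrite eq_le lip_const_ge0 andbT.
by apply: lip_const_le => // x y; rewrite /= subrr /rnorm normr0 mul0r.
Qed.

(* At a constant the Lipschitz seminorm of [F + iaTF] is [|a| L(TF)], while the
   sup norm is convex in [a]: the growth bound forces [L(TF) = 0]. *)
Lemma hermitian_cst e x y : T (lip_cst e) x = T (lip_cst e) y.
Proof.
set F := lip_cst e.
apply/eqP; rewrite -subr_eq0; apply/eqP/rnorm0_eq0/eqP.
rewrite eq_le rnorm_ge0 andbT.
apply: (@le0_of_linear_bound _ _ (rnorm (T (T F)) * mdist x y)) => a a0.
have half (b : R) : rnorm (e + (0 +i* b) *: T F x) +
    lip_const (fn (F + (0 +i* b) *: T F)) <= rnorm e + b ^+ 2 * rnorm (T (T F)).
  apply: (le_trans (lip_growth F b x)).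
  by rewrite lip_const_cst addr0 lerD2r sup_norm_cst.
have seminorm (b : R) : `|b| * rnorm (T F x - T F y) <=
    lip_const (fn (F + (0 +i* b) *: T F)) * mdist x y.
  apply: le_trans (lip_constP _ x y).
  have -> : fn (F + (0 +i* b) *: T F) x - fn (F + (0 +i* b) *: T F) y =
      (e + (0 +i* b) *: T F x) - (e + (0 +i* b) *: T F y) by [].
  rewrite opprD addrACA subrr add0r -scalerBr rnormZ.
  by rewrite cabsE/= expr0n add0r sqrtr_sqr.
have convex : rnorm e *+ 2 <= rnorm (e + (0 +i* a) *: T F x) +
    rnorm (e + (0 +i* - a) *: T F x).
  apply: le_trans (ler_rnormD _ _); rewrite addrACA -scalerDl.
  have -> : (0 +i* a) + (0 +i* - a) = 0 :> R[i].
    by apply/eqP; rewrite eq_complex /= addr0 subrr eqxx.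
  rewrite scale0r addr0.
  have -> : e + e = (2%:R : R[i]) *: e by rewrite scaler_nat mulr2n.
  rewrite rnormZ.
  by rewrite -(rmorph_nat (real_complex R)) cabs_real normr_nat mulr_natl.
have := half a; have := half (- a); rewrite sqrrN => h1 h2.
have := seminorm a; have := seminorm (- a); rewrite normrN (gtr0_norm a0) => s1 s2.
have d0 := mdist_ge0 x y.
rewrite -(ler_pM2l a0).
set L1 := lip_const _ in h1 s1; set L2 := lip_const _ in h2 s2.
set K := rnorm (T (T F)) in h1 h2 *.
(* Adding the bounds at [a] and [-a] cancels [2|e|] by [convex]; the rest is quadratic in [a], while
   [s1] and [s2] are linear. *)
have LK : L1 + L2 <= (a ^+ 2 * K) *+ 2 by lra.
have : (L1 + L2) * mdist x y <= (a ^+ 2 * K) *+ 2 * mdist x y by rewrite ler_wpM2r.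
by rewrite mulrA; lra.
Qed.

(** * The operator induced on E, and the pointwise formula *)

Section AtPoint.
Context (x0 : X) (s : LipX -> LipX -> R[i]) (sP : semi_inner_product s).
Hypothesis sT : forall F, s (T F) F \is Num.real.

(** The candidate for [phi]; by [hermitian_cst] the choice of [x0] is immaterial. *)
Definition cst_part (e : E) : E := T (lip_cst e) x0.
(** The constants form an isometric copy of E, so [s] restricts to a compatible product on E. *)
Definition cst_sip (u v : E) : R[i] := s (lip_cst u) (lip_cst v).

Lemma T_lip_cst e : T (lip_cst e) = lip_cst (cst_part e).
Proof. by apply/val_inj/funext => x; exact: hermitian_cst. Qed.

Lemma rnorm_lip_cst e : rnorm (lip_cst e) = rnorm e.
Proof.
rewrite [LHS]/(lip_norm _) /lip_norm lip_const_cst addr0.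
by apply/eqP; rewrite eq_le sup_norm_cst (rnorm_sup_norm (lip_cst e) x0).
Qed.

Lemma cst_sipP : semi_inner_product cst_sip.
Proof.
have [sl _ _] := sP; split => [a u v w|v|u v].
- by rewrite /cst_sip lip_cst_linear sl.
- by rewrite /cst_sip (sip_diag sP) rnorm_lip_cst rmorphXn/= rnormE.
- rewrite -!rnormE -rmorphM -[`|cst_sip _ _|]RRe_real ?realE ?normr_ge0//= lecR.
  rewrite -(rnorm_lip_cst u) -(rnorm_lip_cst v); exact: (sip_le sP).
Qed.

Lemma hermitian_cst_part : hermitian_operator cst_part.
Proof.
have [[_ [M TM]] _] := hT; split; first split.
- by move=> a u v; rewrite /cst_part lip_cst_linear T_linear.
- exists M => v; rewrite -!rnormE -!rnorm_lip_cst -T_lip_cst !rnormE; exact: TM.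
exists cst_sip => [|v]; first exact: cst_sipP.
by rewrite /cst_sip -T_lip_cst.
Qed.

Let cst_sip_linear (a : R[i]) u v w :
  cst_sip (a *: u + v) w = a * cst_sip u w + cst_sip v w.
Proof. by have [sl _ _] := cst_sipP; exact: sl. Qed.

Let cst_sipZ (a : R[i]) u w : cst_sip (a *: u) w = a * cst_sip u w.
Proof.
have cst0 : cst_sip 0 w = 0.
  have := cst_sip_linear (-1) 0 0 w.
  by rewrite scaler0 addr0 mulN1r addNr.
by rewrite -[a *: u]addr0 cst_sip_linear cst0 addr0.
Qed.

Let cst_part_real e : cst_sip (cst_part e) e \is Num.real.
Proof. by rewrite /cst_sip -T_lip_cst. Qed.

Let cst_partZ (a : R[i]) e : cst_part (a *: e) = a *: cst_part e.
Proof.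
have [[phil _] _] := hermitian_cst_part.
have phi0 : cst_part 0 = 0.
  have := phil (-1) 0 0.
  by rewrite scaler0 addr0 scaleN1r addNr.
by rewrite -[a *: e]addr0 phil phi0 addr0.
Qed.

(** This is the growth bound of [H + m e] at [x1], multiplied by [|m||e|]. The term linear in [a] is
    [-a Im (conj m * z)], where [z = [TH(x1), e]]. *)
Lemma peak_growth (H : LipX) x1 e (m : R[i]) :
  H x1 = 0 ->
  sup_norm (fn (H + lip_cst (m *: e))) <= complex.Re `|m| * rnorm e ->
  exists K : R, forall a : R,
    a * (complex.Im m * complex.Re (cst_sip (T H x1) e)
         - complex.Re m * complex.Im (cst_sip (T H x1) e))
    + complex.Re `|m| * rnorm e *
      (lip_const (fn (H + (0 +i* a) *: T H)) - lip_const H) <= a ^+ 2 * K.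
Proof.
move=> H0 Hm; set G := H + lip_cst (m *: e).
set B := complex.Re `|m| * rnorm e; set z := cst_sip _ _.
have B0 : 0 <= B by rewrite mulr_ge0 ?Re_norm_ge0 ?rnorm_ge0.
exists (B * rnorm (T (T G))) => a.
have TG : T G = T H + lip_cst (m *: cst_part e).
  rewrite T_addcst T_lip_cst; congr (_ + lip_cst _).
  exact: cst_partZ.
have Gx : fn G x1 = m *: e.
  by rewrite -[fn G x1]/(H x1 + m *: e) H0 add0r.
have TGx : fn (T G) x1 = T H x1 + m *: cst_part e by rewrite TG.
have LG : lip_const (fn (G + (0 +i* a) *: T G)) =
    lip_const (fn (H + (0 +i* a) *: T H)).
  rewrite -(lip_const_addcst (H + (0 +i* a) *: T H)
    (m *: e + (0 +i* a) *: (m *: cst_part e))).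
  congr (lip_const (fn _)).
  by rewrite TG /G scalerDr addrACA; congr (_ + _); exact/val_inj.
have := lip_growth G a x1; rewrite LG Gx TGx lip_const_addcst.
set L := lip_const (fn H); set L' := lip_const _; set N := rnorm (_ + _).
set K := rnorm (T (T G)) => growth.
(* Pair the value at [x1] with [e] and multiply by [conj m]; the term with [[cst_part e, e]], which
   is real, becomes purely imaginary. *)
have lower : complex.Re `|m| ^+ 2 * rnorm e ^+ 2 +
    a * (complex.Im m * complex.Re z - complex.Re m * complex.Im z) <= B * N.
  have := sip_le cst_sipP (m *: e + (0 +i* a) *: (T H x1 + m *: cst_part e)) e.
  rewrite -/N => /(ler_wpM2l (Re_norm_ge0 m)).
  rewrite -(normcJ m) -Re_normM normcJ [N * _]mulrC mulrA -/B.
  apply: le_trans; apply: le_trans (Re_le_cabs _); apply: le_trans (ler_norm _).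
  have := cst_part_real e; rewrite complex_Im_real.
  rewrite [m *: e + _]addrC [T H x1 + _]addrC !cst_sip_linear -/z.
  rewrite cst_sipZ (sip_diag cst_sipP) sqr_cabs.
  case: (m) (z) (cst_sip (cst_part e) e) => [m1 m2] [z1 z2] [r1 r2]/= /eqP ->.
  by rewrite le_eqVlt; apply/orP; left; apply/eqP; ring.
have : B * N <= B * (B + L + a ^+ 2 * K - L').
  apply: ler_wpM2l => //; rewrite -/B in Hm; lra.
rewrite -exprMn -/B in lower; nra.
Qed.

(* Adding a constant changes the sup norm but not the Lipschitz seminorm of
   [H + iaTH]; the latter is convex in [a], so [Im (conj m * z)] cannot depend on
   the phase of [m]. *)
Lemma peak_Im_le (H : LipX) x1 e (m m' : R[i]) :
  H x1 = 0 -> complex.Re `|m| = complex.Re `|m'| ->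
  sup_norm (fn (H + lip_cst (m *: e))) <= complex.Re `|m| * rnorm e ->
  sup_norm (fn (H + lip_cst (m' *: e))) <= complex.Re `|m'| * rnorm e ->
  complex.Im m * complex.Re (cst_sip (T H x1) e)
    - complex.Re m * complex.Im (cst_sip (T H x1) e) <=
  complex.Im m' * complex.Re (cst_sip (T H x1) e)
    - complex.Re m' * complex.Im (cst_sip (T H x1) e).
Proof.
move=> H0 mm' /(peak_growth H0)[K hK] /(peak_growth H0)[K' hK'].
rewrite -subr_le0; apply: (@le0_of_linear_bound _ _ (K + K')) => a a0.
have := hK a; have := hK' (- a); rewrite sqrrN -mm'.
have -> : (0 +i* - a) *: T H = - ((0 +i* a) *: T H).
  rewrite -scaleNr; congr (_ *: _).
  by apply/eqP; rewrite eq_complex /= oppr0 !eqxx.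
set B := complex.Re `|m| * rnorm e.
have B0 : 0 <= B by rewrite mulr_ge0 ?Re_norm_ge0 ?rnorm_ge0.
have := ler_wpM2l B0 (lip_const_midpoint H ((0 +i* a) *: T H)).
set L := lip_const H; set L1 := lip_const _; set L2 := lip_const _.
move=> h h1 h2; rewrite -(ler_pM2l a0); lra.
Qed.

(* The numbers [5c], [(3 + 4i)c], [(3 - 4i)c] have equal modulus, and each of them
   satisfies [|m - t| <= |m| - t / 2] for [0 <= t <= c]: subtracting
   [k d(x, x1) e] makes the norm of the function peak at [x1] for all three. *)
Lemma peak_vanish (G : LipX) x1 e (k : R) :
  e != 0 -> 0 <= k ->
  (forall x, rnorm (G x) <= k * mdist x x1 / 2 * rnorm e) ->
  cst_sip (fn (T ((- k)%:C *: lip_dist x1 e + G)) x1) e = 0.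
Proof.
move=> e0 k0 Gk; set H := _ + G.
have HE x : fn H x = (- k)%:C *: ((mdist x x1)%:C *: e) + G x by [].
have H0 : fn H x1 = 0.
  rewrite HE mdistxx scale0r scaler0 add0r; apply/rnorm0_eq0/eqP.
  by rewrite eq_le rnorm_ge0 andbT (le_trans (Gk _))// mdistxx mulr0 !mul0r.
have ne0 : 0 < rnorm e.
  by rewrite lt0r rnorm_ge0 andbT; apply: contra_neq e0 => /rnorm0_eq0.
(* The distance to [x1] is bounded by compactness, through the sup norm of [lip_dist]; adding 1
   makes [c] positive. *)
have [c c0 kc] : exists2 c, 0 < c & forall x, k * mdist x x1 <= c.
  exists (k * (sup_norm (lip_dist x1 e) / rnorm e) + 1) => [|x].
    by rewrite ltr_wpDl// mulr_ge0// divr_ge0 ?sup_norm_ge0 ?rnorm_ge0.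
  rewrite (@le_trans _ _ (k * (sup_norm (lip_dist x1 e) / rnorm e)))// ?lerDl//.
  rewrite ler_wpM2l// ler_pdivlMr//.
  apply: le_trans (rnorm_sup_norm (lip_dist x1 e) x).
  by rewrite rnormZ cabs_real ger0_norm ?mdist_ge0.
have peak (p q : R) : p ^+ 2 + q ^+ 2 = (5 * c) ^+ 2 -> 3 * c <= p ->
    complex.Re `|p +i* q| = 5 * c /\
    sup_norm (fn (H + lip_cst ((p +i* q) *: e))) <=
      complex.Re `|p +i* q| * rnorm e.
  move=> pq pc.
  have mE : complex.Re `|p +i* q| = 5 * c.
    by rewrite cabsE/= pq sqrtr_sqr ger0_norm// mulr_ge0// ltW.
  split => //; rewrite mE; apply: sup_norm_le => [|x].
    by rewrite mulr_ge0 ?rnorm_ge0// mulr_ge0// ltW.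
  have -> : fn (H + lip_cst ((p +i* q) *: e)) x =
      ((p - k * mdist x x1) +i* q) *: e + G x.
    rewrite -[LHS]/(fn H x + (p +i* q) *: e) HE addrAC; congr (_ + _).
    rewrite scalerA -scalerDl; congr (_ *: _); apply/eqP.
    by rewrite eq_complex /=; apply/andP; split; apply/eqP; ring.
  have t0 : 0 <= k * mdist x x1 by rewrite mulr_ge0 ?mdist_ge0.
  have tc := kc x.
  apply: le_trans (ler_rnormD _ _) _; rewrite rnormZ.
  have cabs : complex.Re `|(p - k * mdist x x1) +i* q| <=
      5 * c - k * mdist x x1 / 2.
    (* With [t = k d(x, x1) > 0], squaring reduces this to [3t/4 <= 2p - 5c], which follows from
       [3c <= p] and [t <= c]. *)
    apply: cabs_le => /=; first lra.
    set t := k * mdist x x1 in t0 tc *; nra.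
  have := ler_wpM2r (ltW ne0) cabs; have := Gk x; lra.
have [m1 h1] : _ := peak (5 * c) 0 ltac:(ring) ltac:(lra).
have [m2 h2] : _ := peak (3 * c) (4 * c) ltac:(ring) ltac:(lra).
have [m3 h3] : _ := peak (3 * c) (- (4 * c)) ltac:(ring) ltac:(lra).
have e12 := peak_Im_le H0 (etrans m1 (esym m2)) h1 h2.
have e21 := peak_Im_le H0 (etrans m2 (esym m1)) h2 h1.
have e23 := peak_Im_le H0 (etrans m2 (esym m3)) h2 h3.
have e32 := peak_Im_le H0 (etrans m3 (esym m2)) h3 h2.
move: e12 e21 e23 e32; case: cst_sip => y z /= e12 e21 e23 e32.
(* The inequalities say that [-5cz], [4cy - 3cz] and [-4cy - 3cz] coincide. *)
have cy : c * y = 0 by lra.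
have cz : c * z = 0 by lra.
move: cy cz => /eqP; rewrite mulf_eq0 gt_eqF//= => /eqP -> /eqP.
by rewrite mulf_eq0 gt_eqF//= => /eqP ->.
Qed.

Lemma hermitian_vanish (F : LipX) x1 : F x1 = 0 -> T F x1 = 0.
Proof.
move=> F0; apply/eqP; apply: contraT => e0; set e := T F x1 in e0 *.
have ne0 : rnorm e != 0 by apply: contra_neq e0 => /rnorm0_eq0.
(* Chosen so that [k |e| / 2 = L(F)], which makes [F_le] the Lipschitz bound at [x1]. *)
pose k := 2 * lip_const F / rnorm e.
have k0 : 0 <= k by rewrite divr_ge0 ?rnorm_ge0// mulr_ge0 ?lip_const_ge0.
have F_le x : rnorm (F x) <= k * mdist x x1 / 2 * rnorm e.
  rewrite -[F x]subr0 -F0 (le_trans (lip_constP _ _ _))//.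
  rewrite le_eqVlt; apply/orP; left; apply/eqP; rewrite /k; field.
  exact: ne0.
have zero_le x : rnorm (fn 0 x) <= k * mdist x x1 / 2 * rnorm e.
  rewrite -[fn 0 x]/(0 : E) /rnorm normr0.
  by rewrite mulr_ge0 ?rnorm_ge0// divr_ge0// mulr_ge0 ?mdist_ge0.
have T0 : T 0 = 0.
  have := T_linear (-1) 0 0.
  by rewrite scaler0 addr0 scaleN1r addNr.
have fnD (G : LipX) : fn ((- k)%:C *: T (lip_dist x1 e) + G) x1 =
    (- k)%:C *: T (lip_dist x1 e) x1 + G x1 by [].
(* The case [G = 0] removes the distance term from the case [G = F], leaving [[e, e] = 0]. *)
have := peak_vanish e0 k0 zero_le; rewrite T_linear T0 fnD.
have -> : fn 0 x1 = 0 by [].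
rewrite addr0 => dist0; have := peak_vanish e0 k0 F_le.
rewrite T_linear fnD addrC -[T F x1]scale1r cst_sip_linear dist0 addr0 mul1r.
rewrite (sip_diag cst_sipP) => /eqP; rewrite -[0]/(0%:C) => /eqP/complexI/eqP.
by rewrite expf_eq0/= (negbTE ne0).
Qed.

Lemma hermitian_eq_cst_part (F : LipX) x : T F x = cst_part (F x).
Proof.
pose G : LipX := (-1) *: lip_cst (F x) + F.
have G0 : fn G x = 0.
  have -> : fn G x = -1 *: F x + F x by [].
  by rewrite scaleN1r addNr.
have := hermitian_vanish G0; rewrite T_linear T_lip_cst.
set u := lip_cst (cst_part _).
have -> : fn (-1 *: u + T F) x = -1 *: cst_part (F x) + T F x by [].
by rewrite scaleN1r addrC => /eqP; rewrite subr_eq0 => /eqP.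
Qed.

End AtPoint.
End Necessity.

Theorem theorem2p3 (R : realType) (X : metricType R) (X0 : [set: X] !=set0)
    (cX : compact [set: X]) (E : completeNormedModType R[i])
    (T : Lip E cX -> Lip E cX) :
  hermitian_operator T <->
  exists2 phi : E -> E, hermitian_operator phi &
    forall (F : Lip E cX) (x : X), T F x = phi (F x).
Proof.
split => [hT|[phi hphi Tphi]]; last exact: hermitian_pointwise Tphi.
(* Nonemptiness supplies the point at which [cst_part] evaluates. *)
have [x0 _] := X0; have [_ [s sP sT]] := hT.
exists (cst_part T x0); first exact: hermitian_cst_part sP sT.
by move=> F x; exact: hermitian_eq_cst_part sP sT F x.
Qed.
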